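(* Let $\alpha$ be a composition of $n$, let $J\subset\{1,\dots,n-1\}$ be the set of integers that are not partial sums $\alpha_1+\dots+\alpha_k$ of $\alpha$, and let $U$ be a binary search tree with set of labels $\{1,\dots,n-1\}\setminus J$. The map $I_{U,n}$ is a bijection between $\mathfrak S_\alpha$ and the set of lower sets of $\mathcal R_{U,n}$. Define a partial order $\le_{U,n}$ on $\mathfrak S_\alpha$ by $v\le_{U,n}w$ if and only if $I_{U,n}(v)\subset I_{U,n}(w)$. Then $(\mathfrak S_\alpha,\le_{U,n})$ is a distributive lattice.
   Context: $\mathfrak S_\alpha$ is the set of multipermutations: words of length $n$ with $\alpha_k$ occurrences of the letter $k$ for each $k$. The standardization of $u\in\mathfrak S_\alpha$ is the permutation in $\mathfrak S_n$ obtained by replacing, for each $k$, the occurrences of $k$ from left to right by $\alpha_1+\dots+\alpha_{k-1}+1,\dots,\alpha_1+\dots+\alpha_k$ in increasing order. The poset $\mathcal P_n$ is the set of pairs of integers $(i,j)$ with $1\le i<j\le n$, ordered by $(i_1,j_1)\le(i_2,j_2)$ iff $i_2\le i_1$ and $j_1\le j_2$. $\mathcal P_\alpha$ is its subposet of pairs $(i,j)$ for which there is $m\notin J$ with $i\le m\le j-1$ (these are the possible inversions of standardizations). For $\sigma=\sigma_1\cdots\sigma_{n-1}\in\mathfrak S_{n-1}$ and $1\le k\le n-1$ let $\mathcal R_{\sigma,k}=\{x\in\mathcal P_n: (k,k+1)\le x\text{ and }(\sigma_\ell,\sigma_\ell+1)\not\le x\text{ for all }\ell<\sigma^{-1}(k)\}$.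 These sets partition $\mathcal P_n$; each gets the induced order and $\mathcal R_\sigma$ is the disjoint union of these posets. The binary search tree of a word with distinct letters has as root its first letter, and its left (resp. right) subtree is the binary search tree of the subword of letters smaller (resp. greater) than the root. $\mathcal R_\sigma,\mathcal R_{\sigma,k}$ depend only on the binary search tree $T$ of $\sigma$ and are written $\mathcal R_T,\mathcal R_{T,k}$. Let $(i_{T,k},j_{T,k})=\max\mathcal R_{T,k}$. For $w\in\mathfrak S_n$ (as a word) let $w^{L,k}$ (resp. $w^{R,k}$) be the subword of values in $[i_{T,k},k]$ (resp. $[k+1,j_{T,k}]$). $I_T(w)\subset\mathcal R_T$ is the set such that for $i_{T,k}\le i\le k$, $k+1\le j\le j_{T,k}$: $(i,j)\in I_T(w)$ iff the value $w^{L,k}_{i-i_{T,k}+1}$ appears after the value $w^{R,k}_{j-k}$ in $w$. Let $T$ be any completion of $U$ to a binary search tree with label set $\{1,\dots,n-1\}$ (obtained by inserting the labels in $J$ below the nodes of $U$). $\mathcal R_{U,n}$ is the restriction of the poset $\mathcal R_T$ to $\mathcal P_\alpha$, and for $u\in\mathfrak S_\alpha$ with standardization $w$, $I_{U,n}(u)=I_T(w)\cap\mathcal P_\alpha$. These do not depend on the choice of $T$. *)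

(* Defs.v *)
From mathcomp Require Export all_boot all_order.

Set Implicit Arguments.
Unset Strict Implicit.
Unset Printing Implicit Defensive.

(* The [k]-th part (1-based) of [alpha]
    is [nth 0 alpha k.-1]; words are sequences of naturals. *)

Definition is_composition (n : nat) (alpha : seq nat) : bool :=
  (0 \notin alpha) && (sumn alpha == n).

Definition partial_sums (alpha : seq nat) : seq nat :=
  [seq sumn (take k alpha) | k <- iota 1 (size alpha)].

Definition Jset (n : nat) (alpha : seq nat) : seq nat :=
  [seq m <- iota 1 n.-1 | m \notin partial_sums alpha].

Definition is_multiperm (n : nat) (alpha u : seq nat) : bool :=
  (size u == n) &&
  all (fun k => count_mem k u == nth 0 alpha k.-1) (iota 1 (size alpha)).

Definition multiperm (n : nat) (alpha : seq nat) : Type :=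
  {u : seq nat | is_multiperm n alpha u}.

(* The letter k in position p (0-based) becomes
   alpha_1 + ... + alpha_{k-1} + #{q <= p | u_q = k}. *)
Definition standardization (alpha u : seq nat) : seq nat :=
  [seq (let k := nth 0 u p in
        sumn (take k.-1 alpha) + count_mem k (take p.+1 u))
  | p <- iota 0 (size u)].

Inductive tree : Type := Leaf | Node of tree & nat & tree.

Fixpoint labels (t : tree) : seq nat :=
  if t is Node l k r then labels l ++ k :: labels r else [::].

Fixpoint is_search_tree (t : tree) : bool :=
  if t is Node l k r then
    [&& is_search_tree l, is_search_tree r,
        all (fun x => x < k) (labels l) & all (fun x => k < x) (labels r)]
  else true.

(* [bst_of_word s t]: t is the binary search tree of s, a word with distinct
   letters *)
Fixpoint bst_of_word (s : seq nat) (t : tree) : bool :=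
  match t, s with
  | Leaf, [::] => true
  | Node l k r, x :: s' =>
      [&& k == x, bst_of_word [seq y <- s' | y < x] l
        & bst_of_word [seq y <- s' | x < y] r]
  | _, _ => false
  end.

Fixpoint insert (t : tree) (x : nat) : tree :=
  if t is Node l k r then
    if x < k then Node (insert l x) k r else Node l k (insert r x)
  else Node Leaf x Leaf.

(* The order in which the elements of J are inserted is arbitrary, so T ranges
   over all search trees labelled by {1, ..., n-1} having U as upper part. *)
Definition is_completion (n : nat) (alpha : seq nat) (U T : tree) : Prop :=
  exists2 s : seq nat, perm_eq s (Jset n alpha) & T = foldl insert U s.

(* A pair (i, j) with 1 <= i < j <= n is encoded in
    ['I_n.+1 * 'I_n.+1], so that indices keep their 1-based values. *)

Definition ipair (n : nat) : finType := ('I_n.+1 * 'I_n.+1)%type.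

Definition natpair (n : nat) (x : ipair n) : nat * nat := (val x.1, val x.2).

Definition ple (x y : nat * nat) : bool := (y.1 <= x.1) && (x.2 <= y.2).

Definition Pn (n : nat) : {set ipair n} := [set x : ipair n | 0 < x.1 < x.2].

Definition Palpha (n : nat) (alpha : seq nat) : {set ipair n} :=
  [set x in Pn n |
    has (fun m => (m \notin Jset n alpha) && (x.1 <= m <= x.2.-1))
        (iota 1 n.-1)].

(* R_{sigma,k}; [take (index k sigma) sigma] lists the letters of sigma that
   precede k. *)
Definition Rk (n : nat) (sigma : seq nat) (k : nat) : {set ipair n} :=
  [set x in Pn n |
    ple (k, k.+1) (natpair x) &&
    all (fun l => ~~ ple (l, l.+1) (natpair x)) (take (index k sigma) sigma)].

(* Carrier and order of R_sigma, the disjoint union of the posets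
   R_{sigma,k}. *)
Definition Rcarrier (n : nat) (sigma : seq nat) : {set ipair n} :=
  [set x : ipair n | has (fun k => x \in Rk n sigma k) (iota 1 n.-1)].

Definition Rle (n : nat) (sigma : seq nat) (x y : ipair n) : bool :=
  ple (natpair x) (natpair y) &&
  has (fun k => (x \in Rk n sigma k) && (y \in Rk n sigma k)) (iota 1 n.-1).

Definition RU (n : nat) (alpha sigma : seq nat) : {set ipair n} :=
  Rcarrier n sigma :&: Palpha n alpha.

Definition is_lower_set (n : nat) (alpha sigma : seq nat)
    (A : {set ipair n}) : Prop :=
  A \subset RU n alpha sigma /\
  (forall x y : ipair n, x \in A -> y \in RU n alpha sigma ->
     Rle sigma y x -> y \in A).

(* max R_{sigma,k} (the default value (0, 0) is never reached when sigma is a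
   permutation of 1, ..., n-1 and 1 <= k <= n-1) *)
Definition Rmax (n : nat) (sigma : seq nat) (k : nat) : nat * nat :=
  if [pick x in Rk n sigma k
      | [forall y in Rk n sigma k, ple (natpair y) (natpair x)]] is Some x
  then natpair x else (0, 0).

Definition wL (n : nat) (sigma w : seq nat) (k : nat) : seq nat :=
  [seq v <- w | (Rmax n sigma k).1 <= v <= k].

Definition wR (n : nat) (sigma w : seq nat) (k : nat) : seq nat :=
  [seq v <- w | k.+1 <= v <= (Rmax n sigma k).2].

(* I_T(w); [nth] is 0-based, hence w^{L,k}_{i-i_k+1} and w^{R,k}_{j-k} are the
   entries i-i_k and j-k-1. *)
Definition IT (n : nat) (sigma w : seq nat) : {set ipair n} :=
  [set x : ipair n |
    has (fun k =>
      let: (ik, jk) := Rmax n sigma k in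
      [&& ik <= x.1 <= k, k.+1 <= x.2 <= jk &
          index (nth 0 (wR n sigma w k) (x.2 - k.+1)) w
            < index (nth 0 (wL n sigma w k) (x.1 - ik)) w])
    (iota 1 n.-1)].

Definition IU (n : nat) (alpha sigma : seq nat) (u : multiperm n alpha)
    : {set ipair n} :=
  IT n sigma (standardization alpha (val u)) :&: Palpha n alpha.

(* Some distributive lattice structure on S has [le] as its order; reflexivity,
   antisymmetry and transitivity of [le] are part of that structure. *)
Definition is_distr_lattice (S : Type) (le : rel S) : Prop :=
  exists (d : Order.disp_t) (c : Order.DistrLattice.axioms_ d S),
    forall x y : S, @Order.le d (Order.DistrLattice.Pack c) x y = le x y.

(* Main.v *)
From HB Require Import structures.
From mathcomp Require Import zify.
Require Import Defs.

Set Implicit Arguments.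
Unset Strict Implicit.
Unset Printing Implicit Defensive.

(* A pair (i, j) lies in the component R_{sigma,k} where k is the first letter
   of sigma in [i, j).  Letters of J are inserted below U, so k is outside J as
   soon as [i, j) contains an element outside J; hence R_{U,n} is the union of
   the components with k outside J.  Standardization identifies multipermutations
   with the permutations w in which m precedes m+1 for every m in J.  Such a word
   on an interval [a, b] of values is a shuffle of its subwords on [a, k] and
   [k+1, b], where k is the first letter of sigma in [a, b).  A shuffle is the
   same thing as a lower set of the rectangle R_{sigma,k}, and the two subwords
   are treated recursively; when [a, b) is contained in J, the only word is the
   increasing one.  Lower sets are stable under union and intersection, which
   gives the distributive lattice. *)

(** * Words and shuffles *)

Lemma index_filter_lt (s : seq nat) (p : pred nat) (x y : nat) :
  p x -> p y ->
  (index x (filter p s) < index y (filter p s)) = (index x s < index y s).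
Proof.
move=> px py; elim: s => //= z s IH.
case: ifP => pz /=.
  by case: eqP => // _; case: eqP => // _; rewrite !ltnS.
case: eqP => [zx|_]; first by rewrite zx px in pz.
by case: eqP => [zy|_]; [rewrite zy py in pz | rewrite ltnS].
Qed.

Lemma leq_index_nth (s : seq nat) (i j : nat) :
  uniq s -> i <= j -> j < size s -> index (nth 0 s i) s <= index (nth 0 s j) s.
Proof. by move=> us ij js; rewrite !index_uniq // (leq_ltn_trans ij). Qed.

Lemma leq_index_filter (s : seq nat) (p : pred nat) (i j : nat) :
  uniq s -> i <= j -> j < size (filter p s) ->
  index (nth 0 (filter p s) i) s <= index (nth 0 (filter p s) j) s.
Proof.
move=> us ij js; have is' := leq_ltn_trans ij js.
have pn m : m < size (filter p s) -> p (nth 0 (filter p s) m).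
  by move=> /(mem_nth 0); rewrite mem_filter => /andP[].
rewrite leqNgt -(@index_filter_lt _ p) ?pn // -leqNgt.
by rewrite leq_index_nth ?filter_uniq.
Qed.

Lemma perm_filter_range (w : seq nat) (a b x y : nat) :
  perm_eq w (iota a (b.+1 - a)) -> a <= x -> y <= b ->
  perm_eq [seq v <- w | x <= v <= y] (iota x (y.+1 - x)).
Proof.
move=> pw ax yb; apply: uniq_perm; rewrite ?iota_uniq //.
  by rewrite filter_uniq // (perm_uniq pw) iota_uniq.
move=> v; rewrite mem_filter (perm_mem pw) !mem_iota.
by apply/idP/idP; lia.
Qed.

Lemma size_filter_range (w : seq nat) (a b x y : nat) :
  perm_eq w (iota a (b.+1 - a)) -> a <= x -> y <= b ->
  size [seq v <- w | x <= v <= y] = y.+1 - x.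
Proof.
by move=> pw ax yb; rewrite (perm_size (perm_filter_range pw ax yb)) size_iota.
Qed.

(** Both words are sorted for the strict order of positions in [w], and two sorted words with the
    same letters are equal. *)
Lemma consecutive_iota (w : seq nat) (a m : nat) :
  perm_eq w (iota a m) ->
  (forall v, a <= v -> v.+1 < a + m -> index v w < index v.+1 w) ->
  w = iota a m.
Proof.
move=> pw H.
have uw : uniq w by rewrite (perm_uniq pw) iota_uniq.
have tr : transitive (relpre (index^~ w) ltn) by move=> y x z; apply: ltn_trans.
apply: (irr_sorted_eq tr); last exact: perm_mem.
- by move=> x; rewrite /= ltnn.
- apply/(sortedP 0) => i isz.
  by rewrite /relpre /= !index_uniq // ltnW.
- apply/(sortedP 0) => i; rewrite size_iota => im.
  rewrite /relpre /= !nth_iota //; last exact: ltnW.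
  by rewrite addnS; apply: H; lia.
Qed.

Lemma filter_all_predC (p : pred nat) (s : seq nat) :
  all (predC p) s -> filter p s = [::].
Proof. by elim: s => //= x s IH /andP[/negbTE-> /IH]. Qed.

(** Read [B i j] as: letter [j] of [R] comes before letter [i] of [L]. The words are merged head by
    head. If [B 0 0] holds, monotonicity gives [B i 0] for all [i], so the head of [R] may go first;
    otherwise [B 0 j] fails for all [j] and the head of [L] goes first. *)
Lemma shuffle_exists (p : pred nat) (L R : seq nat) (B : nat -> nat -> bool) :
  all p L -> all (predC p) R ->
  (forall i i' j j', i <= i' -> j' <= j -> i' < size L -> j < size R ->
     B i j -> B i' j') ->
  uniq L -> uniq R ->
  exists w, [/\ filter p w = L, filter (predC p) w = R
    & forall i j, i < size L -> j < size R ->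
      (index (nth 0 R j) w < index (nth 0 L i) w) = B i j].
Proof.
elim: L R B => [|l L IHL] R B.
  move=> _ aR _ _ _; exists R; split=> //; last exact/all_filterP.
  exact: filter_all_predC.
move=> pL; have /andP[pl aL] := pL.
elim: R B => [|r R IHR] B pR monB uL.
  move=> _; exists (l :: L); split=> //; first exact/all_filterP.
  by apply: filter_all_predC; apply: sub_all pL => x /=; case: (p x).
move=> uR; have /andP[/= npr aR] := pR.
have /= /andP[lL uL'] := uL; have /= /andP[rR uR'] := uR.
have nthL i : i < size (l :: L) -> p (nth 0 (l :: L) i).
  by move=> iL; apply: (allP pL); apply: mem_nth.
have nthR j : j < size (r :: R) -> ~~ p (nth 0 (r :: R) j).
  by move=> jR; apply: (allP pR); apply: mem_nth.
case B00 : (B 0 0).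
  have [//||//|//|w [wL wR wB]] := IHR (fun i j => B i j.+1).
    by move=> i i' j j' ii jj iL jR; apply: monB.
  exists (r :: w); split=> [||i j iL jR].
  - by rewrite /= (negbTE npr).
  - by rewrite /= npr wR.
  - have /= /eqP/negbTE -> : r <> nth 0 (l :: L) i.
      by move=> e; rewrite e nthL in npr.
    case: j jR => [|j] jR /=; first by rewrite eqxx; apply/esym/(monB 0 _ 0).
    have /eqP/negbTE -> : r <> nth 0 R j.
      by move=> e; rewrite e mem_nth in rR.
    by rewrite ltnS wB.
have [//|//||//|//|w [wL wR wB]] := IHL (r :: R) (fun i j => B i.+1 j).
  by move=> i i' j j' ii jj iL jR; apply: monB.
exists (l :: w); split=> [||i j iL jR].
- by rewrite /= pl wL.
- by rewrite /= pl.
- have /= /eqP/negbTE -> : l <> nth 0 (r :: R) j.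
    by move=> e; rewrite e in pl; rewrite (negbTE (nthR _ jR)) in pl.
  case: i iL => [|i] iL /=.
    rewrite eqxx ltn0; apply/esym/negbTE/negP => Bj.
    by rewrite (monB 0 0 j 0) in B00.
  have /eqP/negbTE -> : l <> nth 0 L i.
    by move=> e; rewrite e mem_nth in lL.
  by rewrite ltnS wB.
Qed.

(** Compare the first letters. If they lie in different classes, they are the heads of the two
    subwords and occur in opposite orders in [w] and [w'], which contradicts the hypothesis at (0,
    0). Otherwise they are equal and can be removed. *)
Lemma shuffle_unique (p : pred nat) (w w' : seq nat) :
  filter p w = filter p w' -> filter (predC p) w = filter (predC p) w' ->
  (forall i j, i < size (filter p w) -> j < size (filter (predC p) w) ->
     (index (nth 0 (filter (predC p) w) j) w
        < index (nth 0 (filter p w) i) w)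
     = (index (nth 0 (filter (predC p) w) j) w'
        < index (nth 0 (filter p w) i) w')) ->
  uniq w -> uniq w' -> w = w'.
Proof.
elim: w w' => [|x w IH] [|x' w'] //=.
- by case: (p x').
- by case: (p x).
have nthF (q : pred nat) s i : i < size (filter q s) -> nth 0 (filter q s) i \in s.
  by move=> /(mem_nth 0); rewrite mem_filter => /andP[].
case px : (p x); case px' : (p x') => //=.
- move=> [exx' e1] e2 H /andP[xw uw] /andP[xw' uw']; subst x'; congr (_ :: _).
  apply: IH => // i j iL jR; have := H i.+1 j iL jR => /=.
  have /eqP/negbTE -> : x <> nth 0 (filter (predC p) w) j.
    by move=> e; rewrite e nthF in xw.
  have /eqP/negbTE -> : x <> nth 0 (filter p w) i.
    by move=> e; rewrite e nthF in xw.
  by rewrite !ltnS.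
- move=> e1 e2 H _ _; exfalso; move: (H 0 0); rewrite e2 /= !eqxx.
  have /eqP/negbTE xx' : x <> x' by move=> e; rewrite e px' in px.
  by rewrite ?(eq_sym x') xx' => /(_ isT isT).
- move=> e1 e2 H _ _; exfalso; move: (H 0 0); rewrite e1 /= !eqxx.
  have /eqP/negbTE xx' : x <> x' by move=> e; rewrite e in px; rewrite px in px'.
  by rewrite ?(eq_sym x') xx' => /(_ isT isT).
- move=> e1 [exx' e2] H /andP[xw uw] /andP[xw' uw']; subst x'; congr (_ :: _).
  apply: IH => // i j iL jR; have := H i j.+1 iL jR => /=.
  have /eqP/negbTE -> : x <> nth 0 (filter (predC p) w) j.
    by move=> e; rewrite e nthF in xw.
  have /eqP/negbTE -> : x <> nth 0 (filter p w) i.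
    by move=> e; rewrite e nthF in xw.
  by rewrite !ltnS.
Qed.

(** * First letters and components of [R_sigma] *)

(* Junk value 0 when no letter of [s] lies in [[i, j)]. *)
Definition first_in (s : seq nat) (i j : nat) : nat :=
  head 0 [seq y <- s | i <= y < j].

Lemma first_in_sub (s : seq nat) (i j i' j' : nat) :
  i' <= i -> j <= j' -> i <= first_in s i' j' < j ->
  first_in s i j = first_in s i' j'.
Proof.
move=> ii jj; rewrite /first_in.
have -> : [seq y <- s | i <= y < j]
    = [seq y <- [seq y <- s | i' <= y < j'] | i <= y < j].
  by rewrite -filter_predI; apply: eq_filter => y /=; apply/idP/idP; lia.
by case: [seq y <- s | i' <= y < j'] => //= h t ->.
Qed.

(** Turns the condition of [Rk] on the letters preceding [k] into a statement about [first_in]. *)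
Lemma first_in_eq (s : seq nat) (i j k : nat) :
  k \in s -> i <= k < j ->
  all (fun l => ~~ ((i <= l) && (l < j))) (take (index k s) s)
  = (first_in s i j == k).
Proof.
rewrite /first_in => + ikj; elim: s => //= h s IH.
rewrite inE [h == k]eq_sym; case: eqP => [<- _|/eqP kh /= ks].
  by rewrite ikj /= eqxx.
by case: ifP => //= _; [rewrite eq_sym (negbTE kh) | apply: IH].
Qed.

Section FirstLetter.

Variables (n : nat) (sigma : seq nat).
Hypothesis Hsigma : perm_eq sigma (iota 1 n.-1).

Lemma mem_sigma k : (k \in sigma) = (0 < k < n).
Proof. by rewrite (perm_mem Hsigma) mem_iota; apply/idP/idP; lia. Qed.

Lemma first_in_bounds i j : 0 < i < j -> j <= n -> i <= first_in sigma i j < j.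
Proof.
move=> ij jn; rewrite /first_in.
have : i \in [seq y <- sigma | i <= y < j].
  by rewrite mem_filter mem_sigma; lia.
have : all (fun y => i <= y < j) [seq y <- sigma | i <= y < j].
  exact: filter_all.
by case: [seq y <- sigma | i <= y < j] => //= h t /andP[].
Qed.

Lemma mem_Rk (x : ipair n) k : 0 < k < n ->
  (x \in Rk n sigma k) = (x \in Pn n) && (first_in sigma x.1 x.2 == k).
Proof.
move=> kn; rewrite in_set; case xP : (x \in Pn n) => //=.
move: xP; rewrite in_set => x12.
rewrite /ple /natpair /=; case kx : ((x.1 <= k) && (k < x.2)) => /=.
  by rewrite -first_in_eq ?mem_sigma.
apply/esym/negbTE/eqP => e; move: kx; rewrite -e first_in_bounds //.
by rewrite -ltnS ltn_ord.
Qed.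

(* [[a, b]] is the interval attached to a subtree: the labels of the subtree are
   those in [[a, b)], and no pair whose first letter is one of them sticks out. *)
Definition closed (a b : nat) : Prop :=
  [/\ 0 < a, b <= n & forall i j, 0 < i < j -> j <= n ->
      a <= first_in sigma i j < b -> a <= i /\ j <= b].

Lemma closedT : closed 1 n.
Proof. by split=> // i j /andP[i0 _]. Qed.

(** A pair whose first letter lies in [a, b) stays within [a, b]. If its range contained the first
    letter k of [a, b), then k would be its own first letter. So a pair whose first letter is on one
    side of k stays on that side. *)
Lemma closed_split a b : closed a b -> a < b ->
  closed a (first_in sigma a b) /\ closed (first_in sigma a b).+1 b.
Proof.
move=> [a0 bn cl] ab.
have abn : 0 < a < b by rewrite a0.
have := first_in_bounds abn bn; set k := first_in sigma a b => kab.
have key i j : 0 < i < j -> j <= n -> a <= first_in sigma i j < b ->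
    i <= k < j -> first_in sigma i j = k.
  move=> ij jn fij ikj; have [ai jb] := cl i j ij jn fij.
  exact: first_in_sub.
split; split; try by lia.
- move=> i j ij jn fij; have fb := first_in_bounds ij jn.
  have fij' : a <= first_in sigma i j < b by lia.
  have [ai jb] := cl i j ij jn fij'; split=> //.
  by rewrite leqNgt; apply/negP => kj; have := key i j ij jn fij'; lia.
- move=> i j ij jn fij; have fb := first_in_bounds ij jn.
  have fij' : a <= first_in sigma i j < b by lia.
  have [ai jb] := cl i j ij jn fij'; split=> //.
  by rewrite ltnNge; apply/negP => kj; have := key i j ij jn fij'; lia.
Qed.

(** Descent in the search tree, starting from [1, n): each split either happens at [k] or leaves [k]
    in one of the two halves. *)
Lemma closed_exists k : 0 < k < n ->
  exists a b, [/\ closed a b, a <= k < b & first_in sigma a b = k].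
Proof.
move=> kn; suff H m a b : b - a <= m -> a <= k < b -> closed a b ->
    exists a b, [/\ closed a b, a <= k < b & first_in sigma a b = k].
  by apply: (H n 1 n) => //; [lia | apply: closedT].
elim: m a b => [|m IH] a b bam kab cl; first by lia.
have [a0 bn _] := cl.
have ab' : a < b by lia.
have [clL clR] := closed_split cl ab'.
have fb : a <= first_in sigma a b < b by apply: first_in_bounds; rewrite ?a0.
case: (ltngtP k (first_in sigma a b)) => kf; last by exists a, b.
  by apply: (IH a (first_in sigma a b)) => //; lia.
by apply: (IH (first_in sigma a b).+1 b) => //; lia.
Qed.

(** The pair (a, b) itself belongs to the component, and closedness bounds every other member by
    it. *)
Lemma RmaxE a b : closed a b -> a < b ->
  Rmax n sigma (first_in sigma a b) = (a, b).
Proof.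
move=> [a0 bn cl] ab; have ab' : 0 < a < b by rewrite a0.
have := first_in_bounds ab' bn; move kE : (first_in sigma a b) => k kab.
have kn : 0 < k < n by lia.
have inP (y : ipair n) : y \in Rk n sigma k -> (a <= y.1) && (y.2 <= b).
  rewrite mem_Rk // inE => /andP[y12 /eqP fy]; have := ltn_ord y.2 => y2.
  have [|||-> ->//] := cl y.1 y.2; [exact: y12|by []|by rewrite fy].
have an : a < n.+1 by lia.
have bn' : b < n.+1 by lia.
pose x0 : ipair n := (Ordinal an, Ordinal bn').
have x0R : x0 \in Rk n sigma k by rewrite mem_Rk // inE /= ab' kE eqxx.
rewrite /Rmax; case: pickP => [x /andP[xR /forall_inP xmax]|/(_ x0)].
  have := xmax _ x0R; have := inP x xR; rewrite /ple /natpair /=.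
  by move=> /andP[h1 h2] /andP[h3 h4]; congr (_, _); lia.
by rewrite x0R /= => /forall_inP[] y /inP; rewrite /ple /natpair /=.
Qed.

Lemma Rmax_first i j : 0 < i < j -> j <= n ->
  let k := first_in sigma i j in
  exists a b, [/\ closed a b, [/\ a <= i, i <= k, k < j & j <= b],
    first_in sigma a b = k & Rmax n sigma k = (a, b)].
Proof.
move=> ij jn k; have fb := first_in_bounds ij jn.
have kn : 0 < k < n by rewrite /k; lia.
have [a [b [cl kab fk]]] := closed_exists kn.
exists a, b; split=> //; last by rewrite -fk RmaxE //; lia.
have [_ _ /(_ i j ij jn kab)[ai jb]] := cl.
by case/andP: fb.
Qed.

(* Membership of [(i, j)] in [IT n sigma w], read on the only component of
   R_sigma that contains [(i, j)]. *)
Definition crossed (w : seq nat) (i j : nat) : bool :=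
  let k := first_in sigma i j in
  index (nth 0 (wR n sigma w k) (j - k.+1)) w
    < index (nth 0 (wL n sigma w k) (i - (Rmax n sigma k).1)) w.

(** A [k] whose rectangle contains the pair is the first letter of a range containing that of the
    pair, hence the first letter of the pair. So a single [k] can satisfy the condition. *)
Lemma mem_IT (w : seq nat) (x : ipair n) : x \in Pn n ->
  (x \in IT n sigma w) = crossed w x.1 x.2.
Proof.
rewrite !inE => x12; have x2n : x.2 <= n by rewrite -ltnS ltn_ord.
have [a [b [cl [ax xk kx xb] fk Rm]]] := Rmax_first x12 x2n.
rewrite /crossed; apply/hasP/idP => [[k]|cr].
  rewrite mem_iota => k1n.
  have kn : 0 < k < n by lia.
  have [a' [b' [cl' kab fk']]] := closed_exists kn.
  have ab' : a' < b' by lia.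
  have := RmaxE cl' ab'; rewrite fk' => Rm'; rewrite Rm' => /and3P[h1 h2].
  have kE : k = first_in sigma x.1 x.2.
    by rewrite -fk'; apply/esym/first_in_sub; lia.
  by rewrite -kE Rm'.
exists (first_in sigma x.1 x.2); first by rewrite mem_iota; case: cl; lia.
by rewrite Rm /= ax xk kx xb; move: cr; rewrite Rm.
Qed.

End FirstLetter.

(** * Words determined by their crossings *)

(** For [J] equal to [Jset n alpha] and the range from 1 to n, this condition singles out the
    standardizations among the permutations. *)
Definition increasing_on (J : pred nat) (w : seq nat) (a b : nat) : Prop :=
  forall m, a <= m < b -> J m -> index m w < index m.+1 w.

Section Words.

Variables (n : nat) (sigma : seq nat).
Hypothesis Hsigma : perm_eq sigma (iota 1 n.-1).

Notation closed := (closed n sigma).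
Notation first_in := (first_in sigma).
Notation crossed := (crossed n sigma).

Lemma crossed_node (w : seq nat) a b i j : closed a b -> a < b ->
  a <= i <= first_in a b -> first_in a b < j <= b ->
  crossed w i j =
    (index (nth 0 [seq v <- w | first_in a b < v <= b] (j - (first_in a b).+1)) w
     < index (nth 0 [seq v <- w | a <= v <= first_in a b] (i - a)) w).
Proof.
move=> cl ab ai jb; have Rm := RmaxE Hsigma cl ab.
have fij : first_in i j = first_in a b by apply: first_in_sub; lia.
by rewrite /crossed fij /wL /wR Rm.
Qed.

(** By closedness the whole rectangle of the component lies within [c, d], so filtering changes
    neither the two subwords that are compared nor the relative order of their letters. *)
Lemma crossed_filter (w : seq nat) a b c d i j :
  perm_eq w (iota a (b.+1 - a)) -> a <= c -> d <= b -> closed c d ->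
  0 < i < j -> j <= n -> c <= first_in i j < d ->
  crossed [seq v <- w | c <= v <= d] i j = crossed w i j.
Proof.
move=> pw ac db [_ _ cl] ij jn fij.
have [a' [b' [cl' [ai ik kj jb] fk Rm]]] := Rmax_first Hsigma ij jn.
have [a'0 bn' _] := cl'.
have ab : a' < b' by lia.
have [ca bd] : c <= a' /\ b' <= d by apply: cl; rewrite ?a'0 // fk.
rewrite /crossed /wL /wR Rm /=; set k := first_in i j in ik kj fij fk *.
rewrite -!filter_predI.
have sub x y : c <= x -> y <= d ->
    [seq v <- w | predI (fun v => x <= v <= y) (fun v => c <= v <= d) v]
    = [seq v <- w | x <= v <= y].
  by move=> cx yd; apply: eq_filter => v /=; apply/idP/idP; lia.
rewrite !sub; try by lia.
have nthP x y m : c <= x -> y <= d -> m < y.+1 - x ->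
    c <= nth 0 [seq v <- w | x <= v <= y] m <= d.
  move=> cx yd mxy; have : m < size [seq v <- w | x <= v <= y].
    by rewrite (size_filter_range pw) //; lia.
  by move=> /(mem_nth 0); move: (nth _ _ _) => v; rewrite mem_filter => /andP[xy _]; lia.
by apply: index_filter_lt; apply: nthP; lia.
Qed.

(** The source of the lower set property: a larger [i] selects a later letter of the left subword,
    and a smaller [j] an earlier letter of the right one. *)
Lemma crossed_monotone (w : seq nat) i j i' j' :
  perm_eq w (iota 1 n) -> 0 < i < j -> j <= n -> 0 < i' < j' -> j' <= n ->
  first_in i j = first_in i' j' -> i <= i' -> j' <= j ->
  crossed w i j -> crossed w i' j'.
Proof.
move=> pw ij jn ij' jn' ff ii jj.
have pw' : perm_eq w (iota 1 (n.+1 - 1)) by rewrite subSS subn0.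
have uw : uniq w by rewrite (perm_uniq pw) iota_uniq.
have [a [b [cl [ai ik kj jb] fk Rm]]] := Rmax_first Hsigma ij jn.
have fb := first_in_bounds Hsigma ij' jn'.
have [a0 bn _] := cl.
rewrite /crossed -ff /wL /wR Rm /=; set k := first_in i j in ik kj fk *.
move=> lt; apply: leq_ltn_trans (leq_trans lt _); apply: leq_index_filter => //.
- by lia.
- by rewrite (size_filter_range pw') //; lia.
- by lia.
- by rewrite (size_filter_range pw') //; lia.
Qed.

Variable J : pred nat.
(** This is how the position of [J] below [U] in the tree enters. Equivalently, a range whose first
    letter is in [J] is contained in [J]. *)
Hypothesis firstJ : forall i j m, 0 < i -> j <= n -> i <= m < j ->
  ~~ J m -> ~~ J (first_in i j).

Lemma increasing_on_filter (w : seq nat) a b c d :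
  a <= c -> d <= b -> increasing_on J w a b ->
  increasing_on J [seq v <- w | c <= v <= d] c d.
Proof.
move=> ac db inc m cmd Jm.
by rewrite index_filter_lt ?inc //; lia.
Qed.

(** When the first letter of [a, b) is in [J], [firstJ] puts all of [a, b) in [J], so all
    consecutive values appear in order. *)
Lemma increasing_on_leaf (w : seq nat) a b : 0 < a -> b <= n ->
  perm_eq w (iota a (b.+1 - a)) -> ~~ ((a < b) && ~~ J (first_in a b)) ->
  increasing_on J w a b -> w = iota a (b.+1 - a).
Proof.
move=> a0 bn pw leaf inc; apply: consecutive_iota => // v av vb.
apply: inc; first by lia.
apply: contraR leaf => Jv; apply/andP; split; first by lia.
by apply: (firstJ (m := v)) => //; lia.
Qed.

Lemma filter_predC_range (w : seq nat) a b k :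
  perm_eq w (iota a (b.+1 - a)) -> a <= k < b ->
  filter (predC (fun v => a <= v <= k)) w = [seq v <- w | k < v <= b].
Proof.
move=> pw akb; apply: eq_in_filter => v; rewrite (perm_mem pw) mem_iota /=.
by move=> ?; apply/idP/idP; lia.
Qed.

Lemma increasing_word_unique (w w' : seq nat) a b :
  closed a b ->
  perm_eq w (iota a (b.+1 - a)) -> perm_eq w' (iota a (b.+1 - a)) ->
  increasing_on J w a b -> increasing_on J w' a b ->
  (forall i j, 0 < i < j -> j <= n -> a <= first_in i j < b ->
     ~~ J (first_in i j) -> crossed w i j = crossed w' i j) ->
  w = w'.
Proof.
have [m] := ubnP (b - a); elim: m a b w w' => // m IH a b w w' bam cl pw pw'.
move=> inc inc' cr; have [a0 bn _] := cl.
case Hn : ((a < b) && ~~ J (first_in a b)); last first.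
  by rewrite (increasing_on_leaf _ _ pw) ?Hn // (increasing_on_leaf _ _ pw') ?Hn.
case/andP: Hn => ab nJ; have [clL clR] := closed_split Hsigma cl ab.
have ab' : 0 < a < b by rewrite a0.
have := first_in_bounds Hsigma ab' bn.
move kE : (first_in a b) nJ clL clR => k nJ clL clR akb.
have fE c d : a <= c -> d <= b -> closed c d -> d - c < m ->
    [seq v <- w | c <= v <= d] = [seq v <- w' | c <= v <= d].
  move=> ac db cld dcm; apply: (IH c d) => //.
  - exact: perm_filter_range pw ac db.
  - exact: perm_filter_range pw' ac db.
  - exact: increasing_on_filter inc.
  - exact: increasing_on_filter inc'.
  move=> i j ij jn fij nJij.
  rewrite (crossed_filter pw) // (crossed_filter pw') //.
  by apply: cr => //; lia.
have eL : [seq v <- w | a <= v <= k] = [seq v <- w' | a <= v <= k].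
  by apply: fE => //; lia.
have eR : [seq v <- w | k < v <= b] = [seq v <- w' | k < v <= b].
  by apply: fE => //; lia.
apply: (@shuffle_unique (fun v => a <= v <= k)) => //.
- by rewrite (filter_predC_range pw) // (filter_predC_range pw').
- rewrite (filter_predC_range pw) // => i j.
  rewrite !(size_filter_range pw) //; try by lia.
  (* Counting from 0, letter [i] on the left and letter [j] on the right are those compared at the
     pair (i + a, j + k + 1). *)
  move=> ik jk; have := cr (i + a) (j + k.+1).
  rewrite !(crossed_node _ cl ab) ?kE -?eL -?eR ?addnK; try by lia.
  have -> : first_in (i + a) (j + k.+1) = k.
    by rewrite -[RHS]kE; apply: first_in_sub; rewrite ?kE; lia.
  by apply=> //; lia.
- by rewrite (perm_uniq pw) iota_uniq.
- by rewrite (perm_uniq pw') iota_uniq.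
Qed.

(** [A] is a lower set read on naturals; its monotonicity within a component is what
    [shuffle_exists] requires. *)
Lemma increasing_word_exists (A : nat -> nat -> bool) a b :
  (forall i j i' j', 0 < i < j -> j <= n -> 0 < i' < j' -> j' <= n ->
     first_in i j = first_in i' j' -> ~~ J (first_in i j) ->
     i <= i' -> j' <= j -> A i j -> A i' j') ->
  closed a b ->
  exists w, [/\ perm_eq w (iota a (b.+1 - a)), increasing_on J w a b
    & forall i j, 0 < i < j -> j <= n -> a <= first_in i j < b ->
      ~~ J (first_in i j) -> crossed w i j = A i j].
Proof.
move=> lowA; have [m] := ubnP (b - a); elim: m a b => // m IH a b bam cl.
have [a0 bn clo] := cl.
case Hn : ((a < b) && ~~ J (first_in a b)); last first.
  exists (iota a (b.+1 - a)); split=> //.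
    move=> v avb _; rewrite -{1}(subnKC (m := a) (n := v)); last by lia.
    have -> : v.+1 = a + (v.+1 - a) by lia.
    have nthI x : x < b.+1 - a -> index (a + x) (iota a (b.+1 - a)) = x.
      by move=> xb; rewrite -{1}(nth_iota 0 a xb) index_uniq ?iota_uniq ?size_iota.
    by rewrite !nthI; lia.
  (* No crossing is prescribed here: a first letter outside [J] within [a, b) would force the first
     letter of [a, b) outside [J]. *)
  move=> i j ij jn fij; apply: contraNeq => _.
  move: Hn => /negbT; rewrite negb_and -ltnNge ltnS negbK => /orP[|]; first by lia.
  apply: contraLR => /firstJ; apply=> //.
case/andP: Hn => ab nJ; have [clL clR] := closed_split Hsigma cl ab.
have ab' : 0 < a < b by rewrite a0.
have := first_in_bounds Hsigma ab' bn.
move kE : (first_in a b) nJ clL clR => k nJ clL clR akb.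
have [|w1 [pw1 inc1 cr1]] := IH a k _ clL; first by lia.
have [|w2 [pw2 inc2 cr2]] := IH k.+1 b _ clR; first by lia.
have s1 : size w1 = k.+1 - a by rewrite (perm_size pw1) size_iota.
have s2 : size w2 = b - k by rewrite (perm_size pw2) size_iota.
have [||||| w [wL wR wB]] := @shuffle_exists (fun v => a <= v <= k) w1 w2
  (fun i j => A (i + a) (j + k.+1)).
- by apply/allP => v; rewrite (perm_mem pw1) mem_iota; lia.
- by apply/allP => v; rewrite (perm_mem pw2) mem_iota /=; lia.
- move=> i i' j j' ii jj; rewrite s1 s2 => i'k jb.
  have fk x y : a <= x <= k -> k < y <= b -> first_in x y = k.
    by move=> xk yb; rewrite -[RHS]kE; apply: first_in_sub; rewrite ?kE; lia.
  by apply: lowA; rewrite ?fk //; lia.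
- by rewrite (perm_uniq pw1) iota_uniq.
- by rewrite (perm_uniq pw2) iota_uniq.
have pw : perm_eq w (iota a (b.+1 - a)).
  rewrite -(perm_filterC (fun v => a <= v <= k) w) wL wR.
  have -> : b.+1 - a = (k.+1 - a) + (b.+1 - k.+1) by lia.
  rewrite iotaD; have -> : a + (k.+1 - a) = k.+1 by lia.
  exact: perm_cat.
rewrite (filter_predC_range pw) // in wR.
exists w; split=> //.
  (* Since [k] is not in [J], the values [v] and [v.+1] are on the same side of the split, where
     their order is known by induction. *)
  move=> v avb Jv; have vk : v != k by apply: contraL Jv => /eqP->.
  case: (ltnP v k) => vk'.
    rewrite -(@index_filter_lt _ (fun v => a <= v <= k)) ?wL; try by lia.
    by apply: inc1 => //; lia.
  rewrite -(@index_filter_lt _ (fun v => k < v <= b)) ?wR; try by lia.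
  by apply: inc2 => //; lia.
move=> i j ij jn fij nJij.
have [ai jb] := clo i j ij jn fij.
have fb := first_in_bounds Hsigma ij jn.
case: (ltngtP (first_in i j) k) => fk.
- by rewrite -(crossed_filter pw _ _ clL) ?wL ?cr1 //; lia.
- by rewrite -(crossed_filter pw _ _ clR) ?wR ?cr2 //; lia.
rewrite (crossed_node _ cl ab) kE ?wL ?wR; try by lia.
by rewrite wB ?s1 ?s2 ?subnK //; lia.
Qed.

End Words.

(** * Standardization *)

Definition psum (alpha : seq nat) (k : nat) : nat := sumn (take k alpha).

Lemma psumS (alpha : seq nat) k : k < size alpha ->
  psum alpha k.+1 = psum alpha k + nth 0 alpha k.
Proof. by move=> ks; rewrite /psum (take_nth 0 ks) sumn_rcons. Qed.

Lemma psum_pred (alpha : seq nat) k : 0 < k <= size alpha ->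
  psum alpha k = psum alpha k.-1 + nth 0 alpha k.-1.
Proof. by case: k => // k ks; rewrite psumS. Qed.

Lemma leq_psum (alpha : seq nat) k k' : k <= k' -> psum alpha k <= psum alpha k'.
Proof.
by move=> kk'; rewrite /psum -(subnKC kk') takeD sumn_cat leq_addr.
Qed.

Lemma count_take_nth (u : seq nat) (P : pred nat) p : p < size u ->
  P (nth 0 u p) -> count P (take p.+1 u) = (count P (take p u)).+1.
Proof.
by move=> pu Pp; rewrite (take_nth 0 pu) -cats1 count_cat /= Pp addn0 addn1.
Qed.

Lemma leq_count_take (u : seq nat) (P : pred nat) p q : p <= q ->
  count P (take p u) <= count P (take q u).
Proof.
move=> pq; rewrite -(subnKC pq) takeD count_cat; exact: leq_addr.
Qed.

Lemma index_filter_count (s : seq nat) (P : pred nat) v : P v ->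
  index v (filter P s) = count P (take (index v s) s).
Proof.
move=> Pv; elim: s => //= x s IH; case: eqP => [->|xv]; first by rewrite Pv /= eqxx.
by case: ifP => Px /=; rewrite Px ?IH //; case: eqP xv.
Qed.

Section Blocks.

Variables (n : nat) (alpha : seq nat).
Hypothesis sum_alpha : sumn alpha = n.

Notation psum := (psum alpha).

(** The letter whose occurrences standardization sends to [v]; the successor passes from the 0-based
    [find] to letters numbered from 1. *)
Definition block (v : nat) : nat :=
  (find (fun k => v <= psum k.+1) (iota 0 (size alpha))).+1.

Lemma blockP v : 0 < v <= n ->
  [/\ 0 < block v, block v <= size alpha & psum (block v).-1 < v <= psum (block v)].
Proof.
move=> vn; rewrite /block /=; set P := fun k => _.
have s0 : 0 < size alpha by case: alpha sum_alpha => //= e; lia.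
have hasP : has P (iota 0 (size alpha)).
  apply/hasP; exists (size alpha).-1; first by rewrite mem_iota; lia.
  by rewrite /P prednK // /psum take_size sum_alpha; case/andP: vn.
have fs : find P (iota 0 (size alpha)) < size alpha.
  by rewrite -[X in _ < X](size_iota 0) -has_find.
split=> //; apply/andP; split; last first.
  by have := nth_find 0 hasP; rewrite nth_iota.
case fE : (find P _) fs => [|f] fs; first by rewrite /psum take0; case/andP: vn.
have /(before_find 0) : f < find P (iota 0 (size alpha)) by rewrite fE.
by rewrite nth_iota ?(ltnW fs) // /P => /negbT; rewrite -ltnNge.
Qed.

Lemma block_eq v k : 0 < k <= size alpha -> psum k.-1 < v <= psum k -> block v = k.
Proof.
move=> ks vk; have kn : psum k <= n.
  rewrite -sum_alpha -[X in sumn X]take_size; apply: leq_psum; lia.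
have [|b0 bs bv] := @blockP v; first by lia.
case: (ltngtP (block v) k) => // bk.
  have : psum (block v) <= psum k.-1 by apply: leq_psum; lia.
  by lia.
have : psum k <= psum (block v).-1 by apply: leq_psum; lia.
by lia.
Qed.

Lemma psum_Jset k m : psum k.-1 < m < psum k -> m < n -> m \in Jset n alpha.
Proof.
move=> mk mn; rewrite mem_filter mem_iota; apply/andP; split; last by lia.
apply/negP => /mapP[j _ mj]; case: (ltnP j k) => jk.
  have : psum j <= psum k.-1 by apply: leq_psum; lia.
  by rewrite /psum in mk *; lia.
by have := leq_psum alpha jk; rewrite /psum in mk *; lia.
Qed.

(** An [m] that is not a partial sum is not the last value of its block. *)
Lemma block_Jset m : m \in Jset n alpha -> block m.+1 = block m.
Proof.
rewrite mem_filter mem_iota => /andP[/mapP mP mn].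
have [|b0 bs bm] := @blockP m; first by lia.
apply: block_eq; first by rewrite b0.
suff : m != psum (block m) by lia.
by apply/eqP => e; apply: mP; exists (block m); rewrite // mem_iota; lia.
Qed.

Section Standardization.

Variable u : seq nat.
Hypothesis mu : is_multiperm n alpha u.

Lemma multiperm_size : size u = n.
Proof. by case/andP: mu => /eqP. Qed.

Lemma multiperm_count k : 0 < k <= size alpha -> count_mem k u = nth 0 alpha k.-1.
Proof.
move=> ks; case/andP: mu => _ /allP/(_ k); rewrite mem_iota => H.
by apply/eqP/H; lia.
Qed.

(** The prescribed multiplicities of the letters 1, ..., [size alpha] already add up to the length
    n, which leaves no room for another letter. *)
Lemma multiperm_letters p : p < size u -> 0 < nth 0 u p <= size alpha.
Proof.
suff : all (fun v => 0 < v <= size alpha) u.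
  by move=> /allP H pu; apply: H; apply: mem_nth.
have cnt s : s <= size alpha -> count (fun v => 0 < v <= s) u = psum s.
  elim: s => [|s IH] sa.
    by rewrite /psum take0 -[RHS](count_pred0 u); apply: eq_count => v /=; lia.
  rewrite (@psum_pred _ s.+1) // -IH ?(ltnW sa) // -multiperm_count //.
  rewrite -count_predUI [X in _ + X](_ : _ = 0) ?addn0; last first.
    by rewrite -[RHS](count_pred0 u); apply: eq_count => v /=; lia.
  by apply: eq_count => v /=; apply/idP/idP; lia.
by rewrite all_count cnt // multiperm_size /psum take_size sum_alpha.
Qed.

Local Notation st := (standardization alpha u).

Lemma size_standardization : size st = size u.
Proof. by rewrite size_map size_iota. Qed.

Lemma nth_standardization p : p < size u ->
  nth 0 st p = psum (nth 0 u p).-1 + count_mem (nth 0 u p) (take p.+1 u).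
Proof. by move=> pu; rewrite (nth_map 0) ?size_iota // nth_iota // add0n. Qed.

Lemma standardization_bounds p : p < size u ->
  psum (nth 0 u p).-1 < nth 0 st p <= psum (nth 0 u p).
Proof.
move=> pu; have kb := multiperm_letters pu; rewrite nth_standardization //.
rewrite count_take_nth ?addnS ?ltnS ?leq_addr //=.
rewrite (psum_pred kb).
rewrite -multiperm_count // -addnS leq_add2l -count_take_nth //=.
by rewrite -[X in _ <= count_mem _ X]take_size; apply: leq_count_take.
Qed.

Lemma block_standardization p : p < size u -> block (nth 0 st p) = nth 0 u p.
Proof.
by move=> pu; apply: block_eq; [apply: multiperm_letters | apply: standardization_bounds].
Qed.

Lemma map_block_standardization : map block st = u.
Proof.
apply: (@eq_from_nth _ 0); rewrite size_map size_standardization // => p pu.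
by rewrite (nth_map 0) ?size_standardization // block_standardization.
Qed.

Lemma ltn_standardization p q : p < q -> q < size u -> nth 0 u p = nth 0 u q ->
  nth 0 st p < nth 0 st q.
Proof.
move=> pq qu e; rewrite !nth_standardization ?(ltn_trans pq) // e ltn_add2l.
by rewrite [X in _ < X]count_take_nth //= ltnS leq_count_take.
Qed.

(** A value determines its letter through [block], and equal letters get distinct values, so the n
    values are distinct; they all lie in 1, ..., n. *)
Lemma standardization_perm : perm_eq st (iota 1 n).
Proof.
have ust : uniq st.
  apply/(uniqP 0) => p q; rewrite !inE size_standardization => pu qu e.
  have e' : nth 0 u p = nth 0 u q by rewrite -!block_standardization // e.
  case: (ltngtP p q) => // pq.
    by have := ltn_standardization pq qu e'; rewrite e ltnn.
  by have := ltn_standardization pq pu (esym e'); rewrite e ltnn.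
have sub : {subset st <= iota 1 n}.
  move=> v /(nthP 0)[p]; rewrite size_standardization => pu <-.
  have := standardization_bounds pu; have := multiperm_letters pu => kb.
  have : psum (nth 0 u p) <= n.
    by rewrite -sum_alpha -[X in sumn X]take_size; apply: leq_psum; lia.
  by rewrite mem_iota; move: (nth 0 st p) => x h1 h2; lia.
have [|_ e] := uniq_min_size ust sub.
  by rewrite size_iota size_standardization multiperm_size.
by apply: uniq_perm; rewrite ?iota_uniq.
Qed.

(** For [m] in J, [m] and [m.+1] replace two occurrences of one letter, and these are numbered from
    left to right. *)
Lemma standardization_increasing :
  increasing_on [pred m | m \in Jset n alpha] st 1 n.
Proof.
move=> m mn mJ.
have posP v : 0 < v <= n -> v \in st.
  by rewrite (perm_mem standardization_perm) mem_iota; lia.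
have mst : m \in st by apply: posP; lia.
have m1st : m.+1 \in st by apply: posP; lia.
have mi := nth_index 0 mst; have m1i := nth_index 0 m1st.
have := mst; rewrite -index_mem size_standardization => pu.
have := m1st; rewrite -index_mem size_standardization => qu.
have e : nth 0 u (index m st) = nth 0 u (index m.+1 st).
  by rewrite -!block_standardization // mi m1i block_Jset.
case: (ltngtP (index m st) (index m.+1 st)) => // pq.
  by have := ltn_standardization pq pu (esym e); rewrite mi m1i; lia.
by move: m1i; rewrite -pq mi; lia.
Qed.

End Standardization.

(** The preimage replaces each value by its block. Inside a block [w] is increasing, so numbering
    equal letters from left to right restores [w]. *)
Lemma standardization_surj (w : seq nat) :
  perm_eq w (iota 1 n) -> increasing_on [pred m | m \in Jset n alpha] w 1 n ->
  exists2 u, is_multiperm n alpha u & standardization alpha u = w.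
Proof.
move=> pw inc; have pw' : perm_eq w (iota 1 (n.+1 - 1)) by rewrite subSS subn0.
have mw v : (v \in w) = (0 < v <= n).
  by rewrite (perm_mem pw) mem_iota; apply/idP/idP; lia.
have psn k : k <= size alpha -> psum k <= n.
  by move=> ks; rewrite -sum_alpha -[X in sumn X]take_size; apply: leq_psum.
have fE k : 0 < k <= size alpha ->
    filter (fun v => block v == k) w = [seq v <- w | psum k.-1 < v <= psum k].
  move=> ks; apply: eq_in_filter => v; rewrite mw => /blockP[_ _ bv].
  by apply/eqP/idP => [<-//|]; apply: block_eq.
have pf k : 0 < k <= size alpha ->
    perm_eq [seq v <- w | psum k.-1 < v <= psum k]
            (iota (psum k.-1).+1 (nth 0 alpha k.-1)).
  move=> ks; have := perm_filter_range pw' (x := (psum k.-1).+1) (y := psum k).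
  have -> : (psum k).+1 - (psum k.-1).+1 = nth 0 alpha k.-1.
    by rewrite (psum_pred ks); lia.
  by apply=> //; apply: psn; lia.
have mu : is_multiperm n alpha (map block w).
  rewrite /is_multiperm size_map (perm_size pw) size_iota eqxx /=.
  apply/allP => k; rewrite mem_iota => ks; rewrite count_map.
  have ks' : 0 < k <= size alpha by lia.
  by rewrite -size_filter fE // (perm_size (pf k ks')) size_iota.
exists (map block w) => //.
apply: (@eq_from_nth _ 0); rewrite size_standardization size_map // => p pu.
rewrite nth_standardization ?size_map // (nth_map 0) // -map_take count_map.
have vn : 0 < nth 0 w p <= n by rewrite -mw mem_nth.
have [b0 bs bv] := blockP vn.
set v := nth 0 w p in vn b0 bs bv *; set k := block v in b0 bs bv *.
have ks : 0 < k <= size alpha by rewrite b0.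
have uw : uniq w by rewrite (perm_uniq pw) iota_uniq.
have FE : [seq v <- w | psum k.-1 < v <= psum k]
    = iota (psum k.-1).+1 (nth 0 alpha k.-1).
  apply: consecutive_iota (pf k ks) _ => x kx xk.
  have xk' : x.+1 <= psum k by rewrite (psum_pred ks); lia.
  have kn := psn k bs.
  rewrite (@index_filter_lt _ (fun v => psum k.-1 < v <= psum k)); [|lia|lia].
  apply: inc; first by lia.
  by apply: (psum_Jset (k := k)); lia.
(* The entries before position [p] in the block of [v] are counted by the index of [v] in the
   increasing subword [FE]. *)
have cE : count (preim block (pred1 k)) (take p w) = v - (psum k.-1).+1.
  rewrite -{1}(index_uniq 0 pu uw) -index_filter_count; last exact: eqxx.
  have vk : v - (psum k.-1).+1 < nth 0 alpha k.-1.
    by move: bv; rewrite (psum_pred ks); lia.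
  have vE : v = nth 0 (iota (psum k.-1).+1 (nth 0 alpha k.-1)) (v - (psum k.-1).+1).
    by rewrite nth_iota //; lia.
  by rewrite [filter _ _]fE // FE -/v {1}vE index_uniq ?iota_uniq ?size_iota.
by rewrite (count_take_nth pu) ?cE; [lia | exact: eqxx].
Qed.

End Blocks.

(** * Distributive lattices of sets *)

(** Meet and join are chosen preimages of intersection and union; the lattice identities hold for
    sets and are pulled back along the injection [f]. *)
Lemma is_distr_lattice_sets (S : choiceType) (X : finType) (f : S -> {set X}) :
  injective f ->
  (forall x y, exists z, f z == f x :&: f y) ->
  (forall x y, exists z, f z == f x :|: f y) ->
  is_distr_lattice (fun x y : S => f x \subset f y).
Proof.
move=> fI fcap fcup.
pose meet x y := xchoose (fcap x y); pose join x y := xchoose (fcup x y).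
have fmeet x y : f (meet x y) = f x :&: f y by apply/eqP/(xchooseP (fcap x y)).
have fjoin x y : f (join x y) = f x :|: f y by apply/eqP/(xchooseP (fcup x y)).
pose le x y := f x \subset f y; pose lt x y := (y != x) && le x y.
have le_def x y : le x y = (meet x y == x).
  by rewrite -(inj_eq fI) fmeet; apply/setIidPl/eqP.
have meetC : commutative meet by move=> x y; apply: fI; rewrite !fmeet setIC.
have joinC : commutative join by move=> x y; apply: fI; rewrite !fjoin setUC.
have meetA : associative meet by move=> x y z; apply: fI; rewrite !fmeet setIA.
have joinA : associative join by move=> x y z; apply: fI; rewrite !fjoin setUA.
have joinK y x : meet x (join x y) = x.
  by apply: fI; rewrite fmeet fjoin setIC setUK.
have meetK y x : join x (meet x y) = x.
  by apply: fI; rewrite fjoin fmeet setUC setIK.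
have meetUl : left_distributive meet join.
  by move=> x y z; apply: fI; rewrite !(fmeet, fjoin) setIUl.
have meetxx : idempotent_op meet by move=> x; apply: fI; rewrite fmeet setIid.
pose D := @Order.isMeetJoinDistrLattice.Axioms_ (Order.Disp tt tt) S
  (Choice.choice_hasChoice_mixin (Choice.class S)) _ le lt meet join le_def
  (fun _ _ => erefl) meetC joinC meetA joinA joinK meetK meetUl meetxx.
pose L : Order.DistrLattice.type (Order.Disp tt tt) := HB.pack S D.
by exists (Order.Disp tt tt), (Order.DistrLattice.class L).
Qed.

(** * Lower sets *)

Lemma foldl_insert_node (l r : tree) (k : nat) (s : seq nat) :
  foldl insert (Node l k r) s
  = Node (foldl insert l [seq x <- s | x < k]) k
         (foldl insert r [seq x <- s | ~~ (x < k)]).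
Proof. by elim: s l r => //= x s IH l r; case: (x < k); rewrite IH. Qed.

Lemma first_in_filter (s : seq nat) (p : pred nat) i j :
  (forall y, i <= y < j -> p y) -> first_in [seq y <- s | p y] i j = first_in s i j.
Proof.
move=> sub; rewrite /first_in -filter_predI; congr head.
by apply: eq_filter => y /=; case ij : (i <= y < j); rewrite //= sub.
Qed.

(* A label inserted below [U] comes in [s] after all its ancestors, so it cannot
   be the first letter of a range that meets [U]. *)
Lemma first_in_upper_tree (U : tree) (s js : seq nat) i j m :
  is_search_tree U -> bst_of_word s (foldl insert U js) ->
  m \in labels U -> i <= m < j -> first_in s i j \in labels U.
Proof.
elim: U s js => //= l IHl k r IHr s js /and4P[sl sr /allP lk /allP rk].
rewrite foldl_insert_node; case: s => //= x s /and3P[/eqP<- bl br].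
rewrite !mem_cat !inE /first_in /=.
case ikj : (i <= k < j); first by rewrite /= eqxx orbT.
(* The range contains [m] but not the root [k], so it lies on the side of [m], and restricting [s]
   to that subtree keeps its first letter. *)
case/or3P => [ml|/eqP ->|mr] imj; last 1 first.
- have kr := rk _ mr; apply/orP; right; apply/orP; right.
  have := IHr _ _ sr br mr imj; rewrite first_in_filter // => y; lia.
- have kl := lk _ ml; apply/orP; left.
  have := IHl _ _ sl bl ml imj; rewrite first_in_filter // => y; lia.
- by rewrite imj in ikj.
Qed.

Lemma is_lower_setI n alpha sigma (A B : {set ipair n}) :
  is_lower_set alpha sigma A -> is_lower_set alpha sigma B ->
  is_lower_set alpha sigma (A :&: B).
Proof.
move=> [AR lA] [BR lB]; split; first exact: subset_trans (subsetIl _ _) AR.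
move=> x y /setIP[xA xB] yR yx.
by rewrite inE (lA _ _ xA yR yx) (lB _ _ xB yR yx).
Qed.

Lemma is_lower_setU n alpha sigma (A B : {set ipair n}) :
  is_lower_set alpha sigma A -> is_lower_set alpha sigma B ->
  is_lower_set alpha sigma (A :|: B).
Proof.
move=> [AR lA] [BR lB]; split; first by rewrite subUset AR.
move=> x y /setUP[xA|xB] yR yx; rewrite inE.
  by rewrite (lA _ _ xA yR yx).
by rewrite (lB _ _ xB yR yx) orbT.
Qed.

(** * The bijection onto lower sets *)

Section LowerSets.

Variables (n : nat) (alpha sigma : seq nat).
Hypothesis sum_alpha : sumn alpha = n.
Hypothesis Hsigma : perm_eq sigma (iota 1 n.-1).

Notation J := [pred m | m \in Jset n alpha].
Hypothesis firstJ : forall i j m, 0 < i -> j <= n -> i <= m < j ->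
  ~~ J m -> ~~ J (first_in sigma i j).

Lemma PnP (i j : 'I_n.+1) : ((i, j) : ipair n) \in Pn n -> (0 < i < j) /\ j <= n.
Proof. by rewrite inE; split=> //; rewrite -ltnS ltn_ord. Qed.

(** One direction is [firstJ]; for the other, the first letter itself is the required element
    outside [J]. *)
Lemma mem_Palpha (x : ipair n) :
  (x \in Palpha n alpha) = (x \in Pn n) && ~~ J (first_in sigma x.1 x.2).
Proof.
case: x => x1 x2; rewrite in_set; case xP : (_ \in Pn n) => //=.
have [x12 x2n] := PnP xP; have fb := first_in_bounds Hsigma x12 x2n.
apply/hasP/idP => [[m]|nJ].
  rewrite mem_iota => mn /andP[mJ xm]; apply: (firstJ (m := m)) => //; lia.
exists (first_in sigma x1 x2); first by rewrite mem_iota; lia.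
by rewrite nJ; lia.
Qed.

(** The components cover [Pn]: each pair lies in the component of its first letter. *)
Lemma RUE : RU n alpha sigma = Palpha n alpha.
Proof.
apply/setIidPr/subsetP => -[x1 x2]; rewrite mem_Palpha => /andP[xP _].
have [x12 x2n] := PnP xP; have fb := first_in_bounds Hsigma x12 x2n.
rewrite in_set; apply/hasP; exists (first_in sigma x1 x2).
  by rewrite mem_iota; lia.
by rewrite mem_Rk ?xP ?eqxx //; lia.
Qed.

Lemma RleE (x y : ipair n) : x \in Pn n -> y \in Pn n ->
  Rle sigma x y = [&& y.1 <= x.1, x.2 <= y.2
                    & first_in sigma x.1 x.2 == first_in sigma y.1 y.2].
Proof.
case: x y => [x1 x2] [y1 y2] xP yP /=.
have [x12 x2n] := PnP xP; have fb := first_in_bounds Hsigma x12 x2n.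
rewrite /Rle /ple /= -andbA; do 2 congr (_ && _).
apply/hasP/eqP => [[k]|e].
  rewrite mem_iota => kn; rewrite !mem_Rk //; try by lia.
  by move=> /andP[/andP[_ /eqP->] /andP[_ /eqP->]].
exists (first_in sigma x1 x2); first by rewrite mem_iota; lia.
by rewrite !mem_Rk ?xP ?yP ?e ?eqxx //; lia.
Qed.

Lemma mem_IU (u : multiperm n alpha) (x : ipair n) :
  (x \in IU sigma u) = (x \in Palpha n alpha)
    && crossed n sigma (standardization alpha (val u)) x.1 x.2.
Proof.
rewrite in_setI andbC mem_Palpha; case xP : (x \in Pn n) => //=.
by rewrite mem_IT.
Qed.

Lemma IU_lower (u : multiperm n alpha) : is_lower_set alpha sigma (IU sigma u).
Proof.
rewrite /is_lower_set RUE; split; first exact: subsetIr.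
move=> [x1 x2] [y1 y2]; rewrite !mem_IU => /andP[xA cx] yA; rewrite yA /=.
move: (xA) (yA); rewrite !mem_Palpha => /andP[xP _] /andP[yP _].
rewrite RleE // => /and3P[xy yx /eqP e].
have [x12 x2n] := PnP xP; have [y12 y2n] := PnP yP.
apply: crossed_monotone cx => //.
exact: standardization_perm sum_alpha _ (valP u).
Qed.

Let pair_of i j : ipair n := (inord i, inord j).

Lemma pair_ofE i j : 0 < i < j -> j <= n ->
  [/\ pair_of i j \in Pn n, val (pair_of i j).1 = i & val (pair_of i j).2 = j].
Proof. by move=> ij jn; rewrite inE /= !inordK //; lia. Qed.

(** [block] recovers a multipermutation from its standardization, so it suffices to compare
    standardizations, which are determined by their crossings. *)
Lemma IU_inj : injective (fun u : multiperm n alpha => IU sigma u).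
Proof.
move=> u v /= e; apply: val_inj.
rewrite -(map_block_standardization sum_alpha (valP u)).
rewrite -(map_block_standardization sum_alpha (valP v)); congr map.
have pst (t : multiperm n alpha) :
    perm_eq (standardization alpha (val t)) (iota 1 (n.+1 - 1)).
  by rewrite subSS subn0; exact: standardization_perm sum_alpha _ (valP t).
apply: (increasing_word_unique Hsigma firstJ (closedT n sigma)) => //.
- exact: standardization_increasing (valP u).
- exact: standardization_increasing (valP v).
move=> i j ij jn _ nJ; have [xP x1 x2] := pair_ofE ij jn.
have := congr1 (fun B : {set ipair n} => pair_of i j \in B) e.
by rewrite !mem_IU mem_Palpha xP x1 x2 nJ.
Qed.

Lemma IU_surj (A : {set ipair n}) : is_lower_set alpha sigma A ->
  exists u : multiperm n alpha, IU sigma u = A.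
Proof.
rewrite /is_lower_set RUE => -[/subsetP AR lowA].
have [i j i' j' ij jn ij' jn' ff nJ ii jj|w [pw incw crw]] :=
  increasing_word_exists Hsigma firstJ
    (A := fun i j => pair_of i j \in A) _ (closedT n sigma).
  have [xP x1 x2] := pair_ofE ij jn; have [yP y1 y2] := pair_ofE ij' jn'.
  move=> xA; apply: lowA xA _ _; first by rewrite mem_Palpha yP y1 y2 -ff.
  by rewrite RleE // x1 x2 y1 y2 ii jj ff eqxx.
rewrite subSS subn0 in pw.
have [u mu uw] := standardization_surj sum_alpha pw incw.
exists (exist _ u mu); apply/setP => -[x1 x2]; rewrite mem_IU /= uw.
case xP : (_ \in Palpha n alpha) => /=; last first.
  by apply/esym/negbTE/negP => /AR; rewrite xP.
move: xP; rewrite mem_Palpha => /andP[xP nJ]; have [x12 x2n] := PnP xP.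
have fb := first_in_bounds Hsigma x12 x2n.
rewrite crw //; last by lia.
by rewrite /pair_of !inord_val.
Qed.

End LowerSets.

Theorem theorem6p1 (n : nat) (alpha : seq nat) (U T : tree) (sigma : seq nat)
    (Halpha : is_composition n alpha)
    (HU : is_search_tree U)
    (HUlab : labels U =i [seq m <- iota 1 n.-1 | m \notin Jset n alpha])
    (HT : is_completion n alpha U T)
    (Hsigma : perm_eq sigma (iota 1 n.-1))
    (HsigmaT : bst_of_word sigma T) :
  (* I_{U,n} is a bijection from S_alpha onto the lower sets of R_{U,n} *)
  [/\ (forall u : multiperm n alpha, is_lower_set alpha sigma (IU sigma u)),
      injective (fun u : multiperm n alpha => IU sigma u)
    & (forall A : {set ipair n}, is_lower_set alpha sigma A ->
         exists u : multiperm n alpha, IU sigma u = A)] /\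
  is_distr_lattice (fun v w : multiperm n alpha =>
    IU sigma v \subset IU sigma w).
Proof.
case/andP: Halpha => _ /eqP sum_alpha.
(* An [m] outside J is a label of [U], and the first letter of a range meeting [U] is again a label
   of [U]. *)
have firstJ i j m : 0 < i -> j <= n -> i <= m < j ->
    ~~ [pred m | m \in Jset n alpha] m ->
    ~~ [pred m | m \in Jset n alpha] (first_in sigma i j).
  move=> i0 jn imj mJ; case: HT HsigmaT => js _ -> sT.
  have mU : m \in labels U by rewrite HUlab mem_filter mem_iota; move: mJ => /= ->; lia.
  by have := first_in_upper_tree HU sT mU imj; rewrite HUlab mem_filter => /andP[].
have low := IU_lower sum_alpha Hsigma firstJ.
have inj := IU_inj sum_alpha Hsigma firstJ.
have surj := IU_surj sum_alpha Hsigma firstJ.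
split; first by split.
(* Intersections and unions of lower sets are lower sets, hence in the image by surjectivity. *)
apply: (@is_distr_lattice_sets {u | is_multiperm n alpha u} _ _ inj) => v w.
  by have [z zE] := surj _ (is_lower_setI (low v) (low w)); exists z; apply/eqP.
by have [z zE] := surj _ (is_lower_setU (low v) (low w)); exists z; apply/eqP.
Qed.
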